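(* Let $Q=2^m$, let $\epsilon\in\{1,-1\}$, $\ell\in\mathcal L_\epsilon$ and $a\in\mathbb F_Q$. Let $v_a(\epsilon)$ be the number of non-tangent lines $n\ne\ell$ with $\hat\rho(\ell,n)=a$. Then $$v_a(\epsilon)=\begin{cases}2(Q-1)\delta_{\epsilon,1},&\text{if }a=0,\\ Q-\epsilon,&\text{if }a\in\mathbb F_Q^*.\end{cases}$$
   Context: Let $Q=2^m$ and work in $\mathrm{PG}(2,Q)$. Conic and lines. - Points are nonzero vectors up to scalars, and $(a,b,c)^\perp$ denotes the line $aX+bY+cZ=0$. - The conic is $\mathcal O=\{(\xi,\xi^2,1)^\top:\xi\in\mathbb F_Q\}\cup\{(0,1,0)^\top\}$. - The non-tangent lines (meeting $\mathcal O$ in $0$ or $2$ points) are exactly the lines $(1,x,y)^\perp$, $x,y\in\mathbb F_Q$. - Such a line lies in $\mathcal L_1$ (secant) if $\mathrm{Tr}(xy)=0$ and in $\mathcal L_{-1}$ (exterior) if $\mathrm{Tr}(xy)=1$, where $\mathrm{Tr}$ is the absolute trace $\mathbb F_Q\to\mathbb F_2$. Modified cross-ratio. - For $\ell=(1,x,y)^\perp$ and $n=(1,z,u)^\perp$: $\hat\rho(\ell,n)=x^2u^2+y^2z^2+(x+z)(y+u)$. $\delta$ is the Kronecker delta. *)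

(* Defs.v *)
From mathcomp Require Import all_boot all_order all_algebra.

Set Implicit Arguments.
Unset Strict Implicit.
Unset Printing Implicit Defensive.

Import GRing.Theory.
Local Open Scope ring_scope.

Section Conic.
Variable F : finFieldType.

Definition vec3 (a b c : F) : 'cV[F]_3 := \col_(i < 3) [:: a; b; c]`_i.

(* A nonzero vector up to scalars is encoded by the set of all its scalar
   multiples, i.e. by the 1-dimensional subspace it spans. *)
Definition proj_pt (v : 'cV[F]_3) : {set 'cV[F]_3} := [set k *: v | k : F].

(* (a,b,c)^perp, as the set of projective points on aX + bY + cZ = 0. *)
Definition perp (a b c : F) : {set {set 'cV[F]_3}} :=
  [set proj_pt v | v : 'cV[F]_3 & (v != 0) && ((vec3 a b c)^T *m v == 0)].

Definition proj_lines : {set {set {set 'cV[F]_3}}} :=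
  [set perp w.1.1 w.1.2 w.2 | w : F * F * F & w != (0, 0, 0)].

Definition conic : {set {set 'cV[F]_3}} :=
  proj_pt (vec3 0 1 0) |: [set proj_pt (vec3 xi (xi ^+ 2) 1) | xi : F].

Definition nontangent_lines : {set {set {set 'cV[F]_3}}} :=
  [set n in proj_lines | (#|n :&: conic| == 0)%N || (#|n :&: conic| == 2)%N].

(* The absolute trace of a field with 2 ^ m elements, as the sum of the
   conjugates; its values lie in the prime subfield {0, 1} of F. *)
Definition abs_trace (m : nat) (x : F) : F := \sum_(i < m) x ^+ (2 ^ i).

(* Secant lines for eps = 1, exterior lines for eps = -1; only these two values
   of eps are meaningful. *)
Definition line_class (m : nat) (eps : int) : {set {set {set 'cV[F]_3}}} :=
  [set perp 1 p.1 p.2 | p : F * F &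
     abs_trace m (p.1 * p.2) == (if eps == 1 then 0 else 1)].

(* The pair (x, y) with n = (1,x,y)^perp; it exists and is unique when n is a
   non-tangent line, and the default (0, 0) is a dummy otherwise. *)
Definition line_coords (n : {set {set 'cV[F]_3}}) : F * F :=
  odflt (0, 0) [pick p : F * F | n == perp 1 p.1 p.2].

Definition rho_hat (l n : {set {set 'cV[F]_3}}) : F :=
  let: (x, y) := line_coords l in
  let: (z, u) := line_coords n in
  x ^+ 2 * u ^+ 2 + y ^+ 2 * z ^+ 2 + (x + z) * (y + u).

Definition valency (l : {set {set 'cV[F]_3}}) (a : F) : nat :=
  #|[set n in nontangent_lines | (n != l) && (rho_hat l n == a)]|.

End Conic.

(* Main.v *)
(** A non-tangent line is exactly [(1,x,y)^perp] for a unique pair [(x,y)].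
    Translating by [(x,y)], in characteristic 2 the equation
    [rho_hat l n = a] becomes [q (s,t) = a] with [(s,t)] nonzero and
    [q (s,t) = y^2 s^2 + s t + x^2 t^2].  Since every scalar is a square and
    [q] is homogeneous of degree 2, all nonzero values of [q] are taken equally
    often, so it suffices to count the zeros of [q].  By the additive
    Hilbert 90 theorem, [q] is a product of two independent linear forms if
    [Tr (x y) = 0], and it is anisotropic if [Tr (x y) = 1]. *)

Require Import Defs.
From mathcomp Require Import all_boot all_order all_algebra.
From mathcomp Require Import finfield ring zify.

Set Implicit Arguments.
Unset Strict Implicit.
Unset Printing Implicit Defensive.

Import GRing.Theory.
Local Open Scope ring_scope.

(** * Points, lines and the conic of the projective plane in coordinates *)

Section ProjectivePlane.
Variable F : finFieldType.
Implicit Types (a b c k x y : F) (v w : 'cV[F]_3).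

Definition eval_form a b c v : F :=
  a * v 0 0 + b * v 1 0 + c * v (inord 2) 0.

Lemma vec3_dotE a b c v :
  ((vec3 a b c)^T *m v == 0) = (eval_form a b c v == 0).
Proof.
have e : ((vec3 a b c)^T *m v) 0 0 = eval_form a b c v.
  rewrite !mxE /eval_form !big_ord_recl big_ord0 !mxE /= addr0 addrA.
  by congr (_ + _ * v _ _ + _ * v _ _); apply/val_inj; rewrite /= ?inordK.
apply/eqP/eqP => [h|h]; first by rewrite -e h mxE.
by apply/matrixP => i j; rewrite !ord1 e h mxE.
Qed.

Lemma eval_formZ a b c k v :
  eval_form a b c (k *: v) = k * eval_form a b c v.
Proof. by rewrite /eval_form !mxE; ring. Qed.

Lemma eval_form_vec3 a b c x y z :
  eval_form a b c (vec3 x y z) = a * x + b * y + c * z.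
Proof. by rewrite /eval_form !mxE /= inordK. Qed.

Lemma vec3_eq0 x y z : (vec3 x y z == 0) = [&& x == 0, y == 0 & z == 0].
Proof.
apply/eqP/and3P => [v0|[/eqP-> /eqP-> /eqP->]].
  have e i : vec3 x y z i 0 = 0 by rewrite v0 mxE.
  by move: (e 0) (e 1) (e (inord 2)); rewrite !mxE /= inordK //= => -> -> ->.
apply/matrixP => i j; rewrite !mxE.
by case: i => [] [|[|[|]]].
Qed.

Lemma vec3_inj x y z x' y' z' :
  vec3 x y z = vec3 x' y' z' -> [/\ x = x', y = y' & z = z'].
Proof.
move=> e; have h i : vec3 x y z i 0 = vec3 x' y' z' i 0 by rewrite e.
by move: (h 0) (h 1) (h (inord 2)); rewrite !mxE /= inordK.
Qed.

Lemma vec3Z k x y z : k *: vec3 x y z = vec3 (k * x) (k * y) (k * z).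
Proof. by apply/matrixP => i j; rewrite !mxE; case: i => [] [|[|[|]]]. Qed.

Lemma proj_ptP v w : proj_pt v = proj_pt w -> exists k, v = k *: w.
Proof.
move=> e; have: v \in proj_pt v by apply/imsetP; exists 1; rewrite ?scale1r.
by rewrite e => /imsetP [k _ ->]; exists k.
Qed.

(** The linear form is homogeneous, so its vanishing does not depend on the representative of the
    point. *)
Lemma mem_perp a b c v : v != 0 ->
  (proj_pt v \in perp a b c) = (eval_form a b c v == 0).
Proof.
move=> v0; apply/imsetP/idP => [[w]|h].
  rewrite inE vec3_dotE => /andP [_ /eqP w0] /proj_ptP [k ->].
  by rewrite eval_formZ w0 mulr0.
by exists v; rewrite // inE v0 vec3_dotE.
Qed.

Lemma perpZ k a b c : k != 0 -> perp (k * a) (k * b) (k * c) = perp a b c.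
Proof.
move=> k0; congr (imset _ (mem (pred_of_set _))).
apply/setP => v; rewrite !inE !vec3_dotE.
have -> : eval_form (k * a) (k * b) (k * c) v = k * eval_form a b c v.
  by rewrite /eval_form; ring.
by rewrite mulf_eq0 (negPf k0).
Qed.

(** The points [(-x, 1, 0)] and [(-y, 0, 1)] of the line already determine [x] and [y]. *)
Lemma perp1_inj : injective (fun p : F * F => perp 1 p.1 p.2).
Proof.
move=> [x y] [z u] /= e; have h a b c : vec3 a b c != 0 ->
    a + x * b + y * c = 0 -> a + z * b + u * c = 0.
  move=> v0; have := mem_perp 1 x y v0; rewrite e (mem_perp _ _ _ v0).
  by rewrite !eval_form_vec3 !mul1r => E /eqP; rewrite -E => /eqP.
congr pair.
  have := h (- x) 1 0; rewrite vec3_eq0 oner_eq0 andbF !mulr1 !mulr0 !addr0.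
  by rewrite addNr => /(_ isT erefl) /eqP; rewrite addrC subr_eq0 => /eqP.
have := h (- y) 0 1; rewrite vec3_eq0 oner_eq0 !andbF !mulr1 !mulr0 !addr0.
by rewrite addNr => /(_ isT erefl) /eqP; rewrite addrC subr_eq0 => /eqP.
Qed.

Lemma line_coords_perp1 x y : line_coords (perp 1 x y) = (x, y).
Proof.
rewrite /line_coords; case: pickP => [p /eqP e|/(_ (x, y))]; last by rewrite eqxx.
by rewrite -(@perp1_inj (x, y) p).
Qed.

(** Parametrises the conic by the projective line over [F], with [None] as the point at infinity. *)
Definition conic_vec (o : option F) :=
  if o is Some xi then vec3 xi (xi ^+ 2) 1 else vec3 0 1 0.

Lemma conic_vec_neq0 o : conic_vec o != 0.
Proof. by case: o => [xi|]; rewrite vec3_eq0 oner_eq0 ?andbF. Qed.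

Lemma conic_pt_inj : injective (fun o => proj_pt (conic_vec o)).
Proof.
move=> [xi|] [zt|] //= /proj_ptP [k]; rewrite vec3Z => /vec3_inj [].
- by move=> h _; rewrite mulr1 => k1; rewrite h -k1 mul1r.
- by move=> _ _ /eqP; rewrite mulr0 oner_eq0.
- move=> _ + /esym; rewrite mulr1 => + k0.
  by rewrite k0 mul0r => /eqP; rewrite oner_eq0.
Qed.

Lemma conicE : conic F = [set proj_pt (conic_vec o) | o : option F].
Proof.
apply/setP => p; rewrite !inE; apply/orP/imsetP => [[/eqP->|/imsetP [xi _ ->]]|].
- by exists None.
- by exists (Some xi).
- by case=> [[xi|]] _ ->; [right; apply/imsetP; exists xi | left].
Qed.

Lemma card_perp_conic a b c :
  #|perp a b c :&: conic F| = #|[set o | eval_form a b c (conic_vec o) == 0]|.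
Proof.
rewrite -(card_imset _ conic_pt_inj); congr #|pred_of_set _|.
apply/setP => p; rewrite conicE inE; apply/andP/imsetP => [[hp /imsetP [o _ e]]|].
  by exists o; rewrite // inE -(mem_perp _ _ _ (conic_vec_neq0 o)) -e.
case=> o; rewrite inE -(mem_perp _ _ _ (conic_vec_neq0 o)) => ho ->.
by split=> //; apply/imsetP; exists o.
Qed.

End ProjectivePlane.

(** * Arithmetic in characteristic 2 and the classification of lines *)

Section Char2.
Variables (F : finFieldType) (m : nat).
Hypothesis hF : #|F| = (2 ^ m)%N.
Implicit Types (a x y s t w : F).

Let charF2 : 2%N \in [pchar F].
Proof. exact: card_finPcharP hF _. Qed.

Lemma char2_addrr x : x + x = 0. Proof. exact: addrr_pchar2. Qed.

Lemma char2_addr_eq0 x y : (x + y == 0) = (x == y).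
Proof. by rewrite -{1}(oppr_pchar2 charF2 y) subr_eq0. Qed.

Lemma char2_sqrrD x y : (x + y) ^+ 2 = x ^+ 2 + y ^+ 2.
Proof. by rewrite sqrrD mulr2n char2_addrr addr0. Qed.

Lemma char2_sqr_inj : injective (fun x => x ^+ 2).
Proof.
move=> x y /= /eqP; rewrite -char2_addr_eq0 -char2_sqrrD expf_eq0 /=.
by rewrite char2_addr_eq0 => /eqP.
Qed.

Lemma char2_sqr_surj a : exists x, x ^+ 2 = a.
Proof.
have [g _ gK] := injF_bij char2_sqr_inj.
by exists (g a); apply: gK.
Qed.

(** On the affine points the line reads [xi + x * xi ^+ 2 + y = 0]. For nonzero [x] the roots sum to
    [x^-1], so any root comes with a second, different one. For [x = 0] the two points are [None]
    and [Some y]. *)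
Lemma nontangent_perp1 x y : perp 1 x y \in nontangent_lines F.
Proof.
rewrite inE; apply/andP; split.
  by apply/imsetP; exists (1, x, y); rewrite // inE !xpair_eqE oner_eq0.
rewrite card_perp_conic; set A := [set _ | _].
have inA o : (o \in A) =
    if o is Some xi then xi + x * xi ^+ 2 + y == 0 else x == 0.
  by case: o => [xi|]; rewrite inE eval_form_vec3; congr (_ == _); ring.
have [x0|x0] := eqVneq x 0.
  suff -> : A = [set None; Some y] by rewrite cards2 orbT.
  apply/setP => o; rewrite inA !inE; case: o => [xi|]; last by rewrite x0 eqxx.
  by rewrite x0 mul0r addr0 char2_addr_eq0.
have [->|[o oA]] := set_0Vmem A; first by rewrite cards0.
move: oA; rewrite inA; case: o => [xi /eqP xi0|]; last by rewrite (negPf x0).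
suff -> : A = [set Some xi; Some (xi + x^-1)].
  rewrite cards2 /=; set b := _ != _; suff -> : b by [].
  apply/eqP => -[] /eqP; rewrite -{1}(addr0 xi) (inj_eq (addrI xi)) eq_sym.
  by rewrite invr_eq0 (negPf x0).
apply/setP => o; rewrite inA !inE; case: o => [zt|]; last by rewrite (negPf x0).
have -> : zt + x * zt ^+ 2 + y = x * ((zt + xi) * (zt + (xi + x^-1))).
  (* Adding the vanishing value at [xi] makes both sides agree up to doubled terms; [ring] does not
     use characteristic 2, so these are isolated and cancelled by hand. *)
  rewrite -[LHS]addr0 -{1}xi0.
  have -> : x * ((zt + xi) * (zt + (xi + x^-1))) =
     zt * (x * x^-1) + x * zt ^+ 2 + x * xi ^+ 2 + xi * (x * x^-1)
       + (x * zt * xi + x * zt * xi) by ring.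
  rewrite mulfV // !mulr1 char2_addrr addr0.
  have -> : zt + x * zt ^+ 2 + y + (xi + x * xi ^+ 2 + y) =
     zt + x * zt ^+ 2 + x * xi ^+ 2 + xi + (y + y) by ring.
  by rewrite char2_addrr addr0.
by rewrite !mulf_eq0 (negPf x0) !char2_addr_eq0.
Qed.

(** Squaring is bijective, so [b * xi ^+ 2 + c] has exactly one root when [b] is nonzero; when
    [b = 0] only the point at infinity remains. *)
Lemma tangent_perp0 b c : (b, c) != (0, 0) -> #|perp 0 b c :&: conic F| = 1%N.
Proof.
rewrite xpair_eqE card_perp_conic => bc; set A := [set _ | _].
have inA o : (o \in A) =
    if o is Some xi then b * xi ^+ 2 + c == 0 else b == 0.
  by case: o => [xi|]; rewrite inE eval_form_vec3; congr (_ == _); ring.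
have [b0|b0] := eqVneq b 0.
  suff -> : A = [set None] by rewrite cards1.
  apply/setP => o; rewrite inA !inE; case: o => [xi|]; last by rewrite b0 eqxx.
  by move: bc; rewrite b0 eqxx mul0r add0r => /negPf.
have [xi hxi] := char2_sqr_surj (c / b).
suff -> : A = [set Some xi] by rewrite cards1.
apply/setP => o; rewrite inA !inE; case: o => [zt|]; last by rewrite (negPf b0).
rewrite char2_addr_eq0 [RHS](_ : _ = (zt == xi)) //.
rewrite -(inj_eq char2_sqr_inj zt xi) /= hxi -(inj_eq (mulfI b0) (zt ^+ 2)).
by rewrite [b * (c / b)]mulrC divfK.
Qed.

Lemma nontangent_linesE :
  nontangent_lines F = [set perp 1 p.1 p.2 | p : F * F].
Proof.
apply/setP => n; apply/idP/imsetP => [|[p _ ->]]; last exact: nontangent_perp1.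
rewrite inE => /andP [/imsetP [[[a b] c] /= + ->]].
rewrite inE; have [->|a0 _ _] := eqVneq a 0.
  move=> bc; rewrite tangent_perp0 //.
  by apply: contraNneq bc => -[-> ->].
exists (b / a, c / a) => //; rewrite -(perpZ 1 _ _ a0) mulr1 /fst /snd.
by rewrite ![a * (_ / a)]mulrC !divfK.
Qed.

(** * The valency as a fibre count of a binary quadratic form *)

Definition valency_form x y (p : F * F) : F :=
  y ^+ 2 * p.1 ^+ 2 + p.1 * p.2 + x ^+ 2 * p.2 ^+ 2.

Lemma valency_perp1 x y a :
  valency (perp 1 x y) a =
    #|[set p | (p != (0, 0)) && (valency_form x y p == a)]|.
Proof.
have tinj : injective (fun p : F * F => perp 1 (p.1 + x) (p.2 + y)).
  move=> [s t] [s' t'] /= e.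
  by have [/addIr-> /addIr->] := @perp1_inj F (s + x, t + y) (s' + x, t' + y) e.
rewrite /valency -(card_imset _ tinj); congr #|pred_of_set _|.
have key s t : (perp 1 (s + x) (t + y) != perp 1 x y) &&
    (rho_hat (perp 1 x y) (perp 1 (s + x) (t + y)) == a)
    = ((s, t) != (0, 0)) && (valency_form x y (s, t) == a).
  rewrite (inj_eq (@perp1_inj F) (s + x, t + y) (x, y)) !xpair_eqE.
  rewrite -(subr_eq0 (s + x)) -(subr_eq0 (t + y)) !addrK /rho_hat !line_coords_perp1.
  congr (_ && (_ == _)); rewrite /valency_form /= !char2_sqrrD.
  have -> : x ^+ 2 * (t ^+ 2 + y ^+ 2) + y ^+ 2 * (s ^+ 2 + x ^+ 2)
     + (x + (s + x)) * (y + (t + y)) = y ^+ 2 * s ^+ 2 + s * t + x ^+ 2 * t ^+ 2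
       + (x ^+ 2 * y ^+ 2 + x ^+ 2 * y ^+ 2) + (s + (x + x)) * (y + y)
       + (x + x) * t by ring.
  by rewrite !char2_addrr mulr0 mul0r !addr0.
apply/setP => n; rewrite inE nontangent_linesE; apply/andP/imsetP.
  case=> /imsetP [[z u] _ ->] /= h; exists (z - x, u - y); rewrite ?inE /= ?subrK //.
  by rewrite -key !subrK.
case=> [[s t]]; rewrite inE -key => h ->; split=> //.
by apply/imsetP; exists (s + x, t + y).
Qed.

(* Scaling by the square root of [a / b] carries the fibre over [b] to the
   fibre over [a]. *)
Lemma card_valency_form_fibres x y a : a != 0 ->
  (#|F|.-1 * #|[set p | valency_form x y p == a]|
    + #|[set p | valency_form x y p == 0%R]| = #|F| ^ 2)%N.
Proof.
move=> a0; set q := valency_form x y; pose N b := #|[set p | q p == b]|.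
(* An inequality suffices: exchanging [b] and [c] gives the reverse one. *)
have le b c : b != 0 -> c != 0 -> (N b <= N c)%N.
  move=> b0 c0; have [k hk] := char2_sqr_surj (c / b).
  have k0 : k != 0.
    by apply: contraNneq (mulf_neq0 c0 (invr_neq0 b0)) => k0; rewrite -hk k0 expr0n.
  have inj : injective (fun p : F * F => (k * p.1, k * p.2)).
    by move=> [s t] [s' t'] /= [/(mulfI k0)-> /(mulfI k0)->].
  rewrite /N -(card_imset _ inj); apply/subset_leq_card/subsetP => _ /imsetP [p + ->].
  rewrite !inE => /eqP hp.
  have -> : q (k * p.1, k * p.2) = k ^+ 2 * q p.
    by rewrite /q /valency_form /=; ring.
  by rewrite hk hp divfK.
have total : (\sum_b N b = #|F| ^ 2)%N.
  rewrite -mulnn -card_prod -sum1_card (partition_big q xpredT) //=.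
  by apply: eq_bigr => b _; rewrite /N -sum1_card; apply: eq_bigl => p; rewrite inE.
rewrite -total (bigD1 0) //= addnC; congr addn.
rewrite (eq_bigr (fun=> N a)) => [|b b0]; last by apply/eqP; rewrite eqn_leq !le.
by rewrite sum_nat_const cardC1.
Qed.

(** * The absolute trace and its kernel *)

Lemma m_gt0 : (0 < m)%N.
Proof.
by case: (m) hF => // hF1; have := finNzRing_gt1 F; rewrite hF1.
Qed.

Lemma abs_traceD x y : abs_trace m (x + y) = abs_trace m x + abs_trace m y.
Proof.
rewrite /abs_trace -big_split; apply: eq_bigr => i _ /=.
by rewrite exprDn_pchar // pnatX pnatE // charF2.
Qed.

(** Squaring permutes the conjugates cyclically: the last one becomes [x ^+ (2 ^ m) = x]. *)
Lemma abs_trace_sqr x : abs_trace m (x ^+ 2) = abs_trace m x.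
Proof.
case: (m) m_gt0 hF => // n _ hF'.
rewrite /abs_trace big_ord_recr big_ord_recl /= -exprM -expnS -hF' expf_card.
rewrite addrC expn0 expr1; congr (_ + _); apply: eq_bigr => i _.
by rewrite -exprM -expnS.
Qed.

(** The trace is a polynomial function of degree [2 ^ m.-1], which bounds its number of roots. *)
Lemma card_abs_trace_ker :
  (#|[set x : F | abs_trace m x == 0%R]| <= 2 ^ m.-1)%N.
Proof.
set K := [set _ | _]; pose T : {poly F} := \sum_(i < m) 'X^(2 ^ i).
have sT : size T = (2 ^ m.-1).+1.
  rewrite /T; case: (m) m_gt0 => // n _.
  rewrite big_ord_recr /= addrC size_polyDl size_polyXn //.
  rewrite ltnS; apply: (leq_trans (size_sum _ _ _)); apply/bigmax_leqP => i _.
  by rewrite size_polyXn ltn_exp2l.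
have T0 : T != 0 by rewrite -size_poly_eq0 sT.
rewrite -ltnS -sT cardE; apply: max_poly_roots => //; last exact: enum_uniq.
apply/allP => x; rewrite mem_enum inE => /eqP h; apply/rootP; rewrite -[RHS]h.
by rewrite horner_sum; apply: eq_bigr => i _; rewrite hornerXn.
Qed.

(* Additive Hilbert 90: the image of the two-to-one map [w |-> w^2 + w] lies
   in the kernel of the trace, which is no larger. *)
Lemma abs_trace_eq0P x :
  reflect (exists w, x = w ^+ 2 + w) (abs_trace m x == 0).
Proof.
pose f w : F := w ^+ 2 + w; pose I := f @: [set: F].
pose K := [set z : F | abs_trace m z == 0].
have sub : I \subset K.
  apply/subsetP => _ /imsetP [w _ ->].
  by rewrite inE abs_traceD abs_trace_sqr char2_addrr.
have cI : (#|F| <= #|I| * 2)%N.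
  rewrite -[#|F|]sum1_card (partition_big f (mem I)) /= => [|w _]; last exact: imset_f.
  (* Since [f z + f w] factors as [(z + w) * (z + (w + 1))], the fibre through [w] lies in
     [{w, w + 1}]. *)
  rewrite -sum_nat_const; apply: leq_sum => _ /imsetP [w _ ->].
  rewrite sum1_card; apply: (@leq_trans #|[set w; w + 1]|); last first.
    by rewrite cards2; case: eqP.
  apply/subset_leq_card/subsetP => z.
  rewrite -topredE /= => /eqP/eqP; rewrite !inE -char2_addr_eq0.
  have -> : f z + f w = (z + w) * (z + (w + 1)).
    have -> : (z + w) * (z + (w + 1)) = z ^+ 2 + z + (w ^+ 2 + w) + (z * w + z * w).
      by ring.
    by rewrite char2_addrr addr0.
  by rewrite mulf_eq0 !char2_addr_eq0.
have eIK : I = K.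
  apply/eqP; rewrite eqEcard sub /=; apply: leq_trans card_abs_trace_ker _.
  by rewrite -(leq_pmul2r (isT : 0 < 2)%N) -expnSr prednK ?m_gt0 // -hF.
have -> : (abs_trace m x == 0) = (x \in I) by rewrite eIK inE.
by apply: (iffP imsetP) => [[w _ ->]|[w ->]]; exists w.
Qed.

(** * Zeros of the quadratic form *)

Lemma valency_form_anisotropic x y (p : F * F) :
  abs_trace m (x * y) != 0 -> (valency_form x y p == 0) = (p == (0, 0)).
Proof.
move=> Tr1; apply/eqP/eqP => [|->]; last by rewrite /valency_form /=; ring.
case: p => s t; rewrite /valency_form /= => h.
have y0 : y != 0.
  apply: contraNneq Tr1 => ->; rewrite mulr0; apply/abs_trace_eq0P.
  by exists 0; ring.
have [t0|t0] := eqVneq t 0.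
  move: h; rewrite t0 expr0n !mulr0 !addr0 => /eqP.
  by rewrite mulf_eq0 !expf_eq0 /= (negPf y0) /= => /eqP->.
(* Multiplying the zero equation by [y ^+ 2 / t ^+ 2] writes [(x * y) ^+ 2] as [w ^+ 2 + w] with
   [w = y ^+ 2 * s / t], so the trace would vanish. *)
case/negP: Tr1; rewrite -abs_trace_sqr; apply/abs_trace_eq0P.
exists (y ^+ 2 * s / t); apply/eqP; rewrite -char2_addr_eq0; apply/eqP.
have -> : (x * y) ^+ 2 + ((y ^+ 2 * s / t) ^+ 2 + y ^+ 2 * s / t) =
   y ^+ 2 / t ^+ 2 * (y ^+ 2 * s ^+ 2 + s * t + x ^+ 2 * t ^+ 2) by field.
by rewrite h mulr0.
Qed.

Lemma valency_form_split x y : abs_trace m (x * y) = 0 ->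
  exists al be ga de : F, al * de + be * ga = 1 /\
    forall s t, valency_form x y (s, t) = (al * s + be * t) * (ga * s + de * t).
Proof.
move=> /eqP/abs_trace_eq0P [w hw].
suff [al [be [ga [de [h1 h2 h3]]]]] : exists al be ga de : F,
    [/\ al * ga = y ^+ 2, be * de = x ^+ 2 & al * de + be * ga = 1].
  exists al, be, ga, de; split=> // s t; rewrite /valency_form /= -h1 -h2.
  by rewrite -[s * t]mul1r -h3; ring.
have [y0|y0] := eqVneq y 0.
  by exists 0, 1, 1, (x ^+ 2); rewrite y0; split; ring.
(* With [S = y ^+ 2 * s], the form times [y ^+ 2] is [S ^+ 2 + S * t + (x * y) ^+ 2 * t ^+ 2]. As
   [(x * y) ^+ 2 = w ^+ 2 * (w ^+ 2 + 1)], it equals [(S + w ^+ 2 * t) * (S + (w ^+ 2 + 1) * t)];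
   the first factor is then divided by [y ^+ 2]. *)
exists 1, (w ^+ 2 / y ^+ 2), (y ^+ 2), (w ^+ 2 + 1); split; first by ring.
  have -> : x ^+ 2 = (x * y) ^+ 2 / y ^+ 2 by field.
  by rewrite hw char2_sqrrD; ring.
by rewrite divfK ?expf_neq0 // mul1r addrAC char2_addrr add0r.
Qed.

(** The two linear factors serve as new coordinates, in which the zero set is the union of the two
    axes. *)
Lemma card_valency_form_zeros x y : abs_trace m (x * y) = 0 ->
  #|[set p | valency_form x y p == 0]| = (#|F| + #|F|.-1)%N.
Proof.
move=> /valency_form_split [al [be [ga [de [det1 qE]]]]].
pose g (p : F * F) := (al * p.1 + be * p.2, ga * p.1 + de * p.2).
(* The inverse of a matrix of determinant 1 is its adjugate, without signs in characteristic 2. *)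
have gK : cancel g (fun p => (de * p.1 + be * p.2, ga * p.1 + al * p.2)).
  move=> [s t]; rewrite /g /=; congr pair.
    have -> : de * (al * s + be * t) + be * (ga * s + de * t) =
       (al * de + be * ga) * s + (be * de * t + be * de * t) by ring.
    by rewrite det1 mul1r char2_addrr addr0.
  have -> : ga * (al * s + be * t) + al * (ga * s + de * t) =
     (al * de + be * ga) * t + (ga * al * s + ga * al * s) by ring.
  by rewrite det1 mul1r char2_addrr addr0.
have -> : [set p | valency_form x y p == 0] = g @^-1: [set p | p.1 * p.2 == 0].
  by apply/setP => -[s t]; rewrite !inE qE.
rewrite on_card_preimset; last exact/onW_bij/injF_bij/(can_inj gK).
pose A := [set ((0 : F), u) | u : F].
(* The origin is left to [A], which makes the union disjoint. *)
pose B := [set (u, (0 : F)) | u in [set~ (0 : F)]].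
have -> : [set p : F * F | p.1 * p.2 == 0] = A :|: B.
  apply/setP => -[s t]; rewrite !inE mulf_eq0 /=.
  apply/idP/orP => [|[] /imsetP [u _ [-> ->]]]; rewrite ?eqxx ?orbT //.
  have [-> _|s0 /= /eqP->] := eqVneq s 0; first by left; apply/imsetP; exists t.
  by right; apply/imsetP; exists s; rewrite ?inE.
rewrite cardsU disjoint_setI0 ?cards0 ?subn0; last first.
  apply/pred0P => p /=; apply/negP => /andP [/imsetP [u _ ->] /imsetP [u']].
  by rewrite !inE => u0 [e _]; rewrite -e eqxx in u0.
by rewrite !card_imset ?cardsC1 ?cardsT // => [u u' []|u u' []].
Qed.

End Char2.

(** * Assembling the valencies *)

Theorem mainTheorem16 (m : nat) (F : finFieldType) (hF : #|F| = (2 ^ m)%N)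
    (eps : int) (heps : eps = 1 \/ eps = -1)
    (l : {set {set 'cV[F]_3}}) (hl : l \in line_class F m eps) (a : F) :
  (valency l a)%:Z =
    if a == 0 then 2 * ((2 ^ m)%N%:Z - 1) * (eps == 1)%:R
    else (2 ^ m)%N%:Z - eps.
Proof.
case/imsetP: hl => -[x y] /=; rewrite inE /= => hTr ->.
rewrite (valency_perp1 hF) -hF.
have Q1 := finNzRing_gt1 F.
pose N0 := #|[set p | valency_form x y p == 0]|.
have N0E : N0 = (if eps == 1 then #|F| + #|F|.-1 else 1)%N.
  case: heps hTr => -> /= /eqP hTr; first exact: (card_valency_form_zeros hF).
  rewrite -(cards1 ((0, 0) : F * F)); congr #|pred_of_set _|.
  apply/setP => p; rewrite !inE (valency_form_anisotropic hF) //.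
  by rewrite hTr oner_eq0.
have q0 : valency_form x y (0, 0) = 0 by rewrite /valency_form /=; ring.
have [->|a0] := eqVneq a 0.
  (* The origin corresponds to [n = l]: it counts in [N0] but not in the valency. *)
  have : N0 = #|[set p | (p != (0, 0)) && (valency_form x y p == 0)]|.+1.
    rewrite /N0 (cardsD1 (0, 0) [set p | _ p == 0]) inE q0 eqxx -add1n.
    by congr addn; apply: eq_card => p; rewrite !inE.
  by rewrite N0E; case: heps => ->; rewrite /= ?mulr1 ?mulr0; lia.
have -> : [set p | (p != (0, 0)) && (valency_form x y p == a)]
    = [set p | valency_form x y p == a].
  apply/setP => p; rewrite !inE; case: eqP => //= ->.
  by rewrite q0 eq_sym (negPf a0).
have := card_valency_form_fibres hF x y a0; rewrite -/N0 N0E.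
(* With [Q = q.+2], the fibre identity gives [(Q - 1) * M = Q ^ 2 - N0], which is [(Q - 1) ^ 2] for
   secants and [(Q - 1) * (Q + 1)] for exterior lines; [q.+1 = Q - 1] is cancelled. *)
move: #|[set p | _ == a]| => M; move: #|F| Q1 => [|[|q]] // _ /=.
case: heps => -> /= cnt.
  suff : (q.+1 * M = q.+1 * q.+1)%N by move/eqP; rewrite eqn_pmul2l // => /eqP; lia.
  by move: cnt; rewrite -mulnn; lia.
suff : (q.+1 * M = q.+1 * q.+3)%N by move/eqP; rewrite eqn_pmul2l // => /eqP; lia.
by move: cnt; rewrite -mulnn; lia.
Qed.
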